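(* A commutative ring is a Nisnevich local object, i.e. a local object of the Nisnevich context $(CRings^o=(Hens^o,indEt^o),\mathcal{F})$ where $\mathcal{F}$ is the class of fields, if and only if it is a henselian local ring.
   Context: $CRings$ is the category of commutative unital rings. $Et^f$ is the class of etale ring maps of finite presentation and $Et^f_*$ the class of etale maps between rings of finite presentation over $\mathbb{Z}$. $Hens$ is the class of ring maps having the unique right lifting property with respect to $Et^f_*$, and $indEt$ is the class of maps having the unique left lifting property with respect to $Hens$; $(indEt,Hens)$ is a unique factorisation system on $CRings$, and the finitely presented maps in $indEt$ are those of $Et^f$. A ring $K$ is a point of this system if $K\ne0$ and every map $K\to B$ in $Et^f$ with $B\neq 0$ admits a retraction. An etale point covering family of $A$ is a family $\{A\to A_i\}$ of maps in $Et^f$ such that every ring map $A\to K$ with $K$ a point factors through some $A\to A_i$. It is a Nisnevich covering family if moreover every map $A\to K$ to a field $K$ factors through some $A\to A_i$. A ring $B$ is a Nisnevich local object if for every Nisnevich covering family $\{A\to A_i\}$ of a ring $A$, every ring map $A\to B$ factors through some $A\to A_i$. A local ring $(A,m)$ is henselian if every etale map $A\to B$ for which there is a maximal ideal $n$ of $B$ over $m$ with the same residue field has a retraction. *)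

(* Defs.v *)
From mathcomp Require Import all_boot ssralg.

Set Implicit Arguments.
Unset Strict Implicit.
Unset Printing Implicit Defensive.

Import GRing.Theory.
Local Open Scope ring_scope.

(* MathComp world.  Commutative rings are [comPzRingType]s, so that the zero  *)
(* ring is allowed, and equality of ring maps is pointwise equality.          *)

(* [iota : A -> P] and [x] exhibit P as the polynomial ring A[x_0,...,x_n-1], *)
(* i.e. the free commutative A-algebra on the x_i.  The library's {mpoly A[n]} *)
(* cannot serve as a definition because it requires A to be nonzero.          *)
Definition polynomial_ring (A P : comPzRingType) (n : nat)
    (iota : {rmorphism A -> P}) (x : 'I_n -> P) : Prop :=
  forall (C : comPzRingType) (g : {rmorphism A -> C}) (c : 'I_n -> C),
  exists h : {rmorphism P -> C},
    [/\ h \o iota =1 g, h \o x =1 c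
      & forall h' : {rmorphism P -> C},
          h' \o iota =1 g -> h' \o x =1 c -> h' =1 h].

(* B is A-isomorphic to A[x_0,...,x_n-1] / (r_0,...,r_k-1). *)
Definition finitely_presented (A B : comPzRingType)
    (f : {rmorphism A -> B}) : Prop :=
  exists (n : nat) (P : comPzRingType) (iota : {rmorphism A -> P})
         (x : 'I_n -> P) (pi : {rmorphism P -> B}) (k : nat) (r : 'I_k -> P),
    [/\ polynomial_ring iota x,
        pi \o iota =1 f,
        forall b : B, exists p : P, pi p = b
      & forall p : P,
          pi p = 0 <-> exists c : 'I_k -> P, p = \sum_(j < k) c j * r j].

Definition unique_lifting (A B R S : comPzRingType)
    (f : {rmorphism A -> B}) (p : {rmorphism R -> S}) : Prop :=
  forall (u : {rmorphism A -> R}) (v : {rmorphism B -> S}),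
  v \o f =1 p \o u ->
  exists w : {rmorphism B -> R},
    [/\ w \o f =1 u, p \o w =1 v
      & forall w' : {rmorphism B -> R},
          w' \o f =1 u -> p \o w' =1 v -> w' =1 w].

Definition square_zero_surjection (R S : comPzRingType)
    (p : {rmorphism R -> S}) : Prop :=
  (forall s : S, exists r : R, p r = s) /\
  (forall x y : R, p x = 0 -> p y = 0 -> x * y = 0).

Definition formally_etale (A B : comPzRingType)
    (f : {rmorphism A -> B}) : Prop :=
  forall (R S : comPzRingType) (p : {rmorphism R -> S}),
  square_zero_surjection p -> unique_lifting f p.

Definition etale (A B : comPzRingType) (f : {rmorphism A -> B}) : Prop :=
  formally_etale f /\ finitely_presented f.

Definition has_retraction (A B : comPzRingType)
    (f : {rmorphism A -> B}) : Prop :=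
  exists r : {rmorphism B -> A}, cancel f r.

Definition etale_point (K : comPzRingType) : Prop :=
  (1 : K) <> 0 /\
  forall (B : comPzRingType) (f : {rmorphism K -> B}),
    etale f -> (1 : B) <> 0 -> has_retraction f.

Definition factors_through_family (A K : comPzRingType) (I : Type)
    (Ai : I -> comPzRingType) (f : forall i, {rmorphism A -> Ai i})
    (u : {rmorphism A -> K}) : Prop :=
  exists (i : I) (g : {rmorphism Ai i -> K}), g \o f i =1 u.

Definition etale_point_covering (A : comPzRingType) (I : Type)
    (Ai : I -> comPzRingType) (f : forall i, {rmorphism A -> Ai i}) : Prop :=
  (forall i, etale (f i)) /\
  (forall (K : comPzRingType) (u : {rmorphism A -> K}),
     etale_point K -> factors_through_family f u).

Definition nisnevich_covering (A : comPzRingType) (I : Type)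
    (Ai : I -> comPzRingType) (f : forall i, {rmorphism A -> Ai i}) : Prop :=
  etale_point_covering f /\
  (forall (K : fieldType) (u : {rmorphism A -> K}),
     factors_through_family f u).

Definition nisnevich_local (B : comPzRingType) : Prop :=
  forall (A : comPzRingType) (I : Type) (Ai : I -> comPzRingType)
         (f : forall i, {rmorphism A -> Ai i}),
  nisnevich_covering f ->
  forall u : {rmorphism A -> B}, factors_through_family f u.

Definition is_ideal (A : comPzRingType) (J : A -> Prop) : Prop :=
  [/\ J 0, forall x y, J x -> J y -> J (x + y)
    & forall a x, J x -> J (a * x)].

Definition maximal_ideal (A : comPzRingType) (m : A -> Prop) : Prop :=
  [/\ is_ideal m, ~ m 1
    & forall J : A -> Prop, is_ideal J -> ~ J 1 ->
        (forall x, m x -> J x) -> forall x, J x -> m x].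

Definition local_ring (A : comPzRingType) (m : A -> Prop) : Prop :=
  maximal_ideal m /\
  forall n : A -> Prop, maximal_ideal n -> forall x, n x <-> m x.

Definition lies_over (A B : comPzRingType) (f : {rmorphism A -> B})
    (n : B -> Prop) (m : A -> Prop) : Prop :=
  forall a : A, n (f a) <-> m a.

(* Bijectivity of the map A/m -> B/n induced by f, spelled out on             *)
(* representatives; meant for n lying over m.                                 *)
Definition same_residue_field (A B : comPzRingType) (f : {rmorphism A -> B})
    (n : B -> Prop) (m : A -> Prop) : Prop :=
  (forall a a' : A, n (f a - f a') -> m (a - a')) /\
  (forall b : B, exists a : A, n (b - f a)).

Definition henselian (A : comPzRingType) (m : A -> Prop) : Prop :=
  forall (B : comPzRingType) (f : {rmorphism A -> B}), etale f ->
  (exists n : B -> Prop,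
     [/\ maximal_ideal n, lies_over f n m & same_residue_field f n m]) ->
  has_retraction f.

Definition henselian_local_ring (A : comPzRingType) : Prop :=
  exists m : A -> Prop, local_ring m /\ henselian m.

(* Main.v *)
Require Import Defs.
From mathcomp Require Import all_boot ssralg.
From HB Require Import structures.
From mathcomp Require Import boolp.

(** Both directions come down to choosing the right covering family, together
    with the stability of etale maps under base change.

    If B is henselian local with residue field k, and {A -> A_i} is a
    Nisnevich covering family with a map A -> B, then A -> B -> k factors
    through some A_i because k is a field.  The base change D of A_i along
    A -> B is etale over B, and the induced map D -> k is surjective with
    kernel a maximal ideal over m with residue field k.  The henselian property
    retracts B -> D, and the composite A_i -> D -> B is the factorisation
    ([henselian_local_is_nisnevich_local]).

    Conversely let B be a Nisnevich local object; the covering property is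
    applied to the identity of B.  If 1 = 0 in B, the empty family covers B,
    and nothing factors through it.  The localisations of B at y and 1 - y
    cover B, because fields and points are local rings; hence y or 1 - y is
    invertible in B, and B is local.  A point K is local because the
    localisation of K at y is etale: either it is nonzero and a retraction
    makes y invertible, or it is zero and then 1 - y is invertible
    ([etale_point_invertible]).  Finally let f : B -> C be etale with a maximal
    ideal over m and the same residue field.  Then C together with all the
    localisations of B at elements of m covers B: a map from B to a local ring
    K either inverts an element of m or is local.  In the latter case, if K is
    a field, then the map kills m and so extends to C through the residue
    field; if K is a point, the same remark for the residue field of K shows
    that the base change of C to K is nonzero, so it has a retraction, which
    provides a map C -> K.  A factorisation of the identity of B through the
    localisation at x in m would make x invertible, so the identity factors
    through C ([nisnevich_local_henselian]).

    The ring theory underneath consists of quotients, polynomial rings,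
    pushouts and localisations.  As formal etaleness is defined by lifting
    against all square-zero surjections, it passes to pushouts and is checked
    on localisations directly from the universal properties; no structure
    theorem for etale maps enters. *)

Set Implicit Arguments.
Unset Strict Implicit.
Unset Printing Implicit Defensive.

Import GRing.Theory.
Local Open Scope ring_scope.
Local Open Scope quotient_scope.

(** * Quotients and ring maps *)

(** The ring laws are only required up to [E], so that both a ring with an
    ideal and a set of formal expressions are instances. *)
Record ring_congruence (T : Type) (E : T -> T -> Prop) (zero one : T)
    (opp : T -> T) (add mul : T -> T -> T) : Prop := RingCongruence {
  cong_refl : forall x, E x x;
  cong_sym : forall x y, E x y -> E y x;
  cong_trans : forall y x z, E x y -> E y z -> E x z;
  cong_opp : forall x x', E x x' -> E (opp x) (opp x');
  cong_add : forall x x' y y', E x x' -> E y y' -> E (add x y) (add x' y');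
  cong_mul : forall x x' y y', E x x' -> E y y' -> E (mul x y) (mul x' y');
  cong_addA : forall x y z, E (add x (add y z)) (add (add x y) z);
  cong_addC : forall x y, E (add x y) (add y x);
  cong_add0 : forall x, E (add zero x) x;
  cong_addN : forall x, E (add (opp x) x) zero;
  cong_mulA : forall x y z, E (mul x (mul y z)) (mul (mul x y) z);
  cong_mulC : forall x y, E (mul x y) (mul y x);
  cong_mul1 : forall x, E (mul one x) x;
  cong_mulD : forall x y z, E (mul (add x y) z) (add (mul x z) (mul y z)) }.

Lemma quotient_by_congruence T E zero one opp add mul :
  @ring_congruence T E zero one opp add mul ->
  exists (Q : comPzRingType) (cl : T -> Q),
    [/\ forall q, exists t, cl t = q,
        forall x y, cl x = cl y <-> E x y,
        cl zero = 0 /\ cl one = 1,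
        {morph cl : x / opp x >-> - x}
      & {morph cl : x y / add x y >-> x + y} /\
        {morph cl : x y / mul x y >-> x * y}].
Proof.
case=> Er Es Et Eo Ea Em aA aC a0 aN mA mC m1 mD.
pose e (x y : {classic T}) := `[< E x y >].
have er : reflexive e by move=> x; apply/asboolP.
have es : symmetric e by move=> x y; apply/asboolP/asboolP; apply: Es.
have et : transitive e.
  by move=> y x z /asboolP xy /asboolP yz; apply/asboolP/(Et y).
pose Q := {eq_quot EquivRel e er es et}.
pose cl (x : T) : Q := \pi_Q (x : {classic T}).
pose rp (q : Q) : T := repr q.
have clE x y : cl x = cl y <-> E x y.
  by split=> [/eqmodP/asboolP //|xy]; apply/eqmodP/asboolP.
have rpK q : cl (rp q) = q by exact: reprK.
have rp_cl x : E (rp (cl x)) x by apply/clE; rewrite rpK.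
have cl_surj q : exists t, cl t = q by exists (rp q).
pose qopp q := cl (opp (rp q)).
pose qadd p q := cl (add (rp p) (rp q)).
pose qmul p q := cl (mul (rp p) (rp q)).
have coppE x : cl (opp x) = qopp (cl x) by apply/clE/Eo/Es/rp_cl.
have caddE x y : cl (add x y) = qadd (cl x) (cl y).
  by apply/clE/Ea; apply/Es/rp_cl.
have cmulE x y : cl (mul x y) = qmul (cl x) (cl y).
  by apply/clE/Em; apply/Es/rp_cl.
have qaA : associative qadd.
  by move=> p q r; rewrite -(rpK p) -(rpK q) -(rpK r) -!caddE; apply/clE.
have qaC : commutative qadd.
  by move=> p q; rewrite -(rpK p) -(rpK q) -!caddE; apply/clE.
have qa0 : left_id (cl zero) qadd.
  by move=> p; rewrite -(rpK p) -!caddE; apply/clE.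
have qaN : left_inverse (cl zero) qopp qadd.
  by move=> p; rewrite -(rpK p) -coppE -caddE; apply/clE.
have qmA : associative qmul.
  by move=> p q r; rewrite -(rpK p) -(rpK q) -(rpK r) -!cmulE; apply/clE.
have qmC : commutative qmul.
  by move=> p q; rewrite -(rpK p) -(rpK q) -!cmulE; apply/clE.
have qm1 : left_id (cl one) qmul.
  by move=> p; rewrite -(rpK p) -!cmulE; apply/clE.
have qmD : left_distributive qmul qadd.
  move=> p q r; rewrite -(rpK p) -(rpK q) -(rpK r).
  by rewrite -caddE -!cmulE -caddE; apply/clE.
pose QZ : zmodType := HB.pack Q (GRing.isZmodule.Build Q qaA qaC qa0 qaN).
pose QR : comPzRingType :=
  HB.pack QZ (GRing.Zmodule_isComPzRing.Build QZ qmA qmC qm1 qmD).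
by exists QR, cl; split.
Qed.

(** Maps out of a quotient are easiest to give as relations: a value for each
    representative, with well-definedness as functionality of the graph. *)
Lemma rmorphism_of_graph (R S : comPzRingType) (G : R -> S -> Prop) :
  (forall x, exists y, G x y) ->
  (forall x y y', G x y -> G x y' -> y = y') ->
  G 1 1 ->
  (forall x x' y y', G x y -> G x' y' -> G (x - x') (y - y')) ->
  (forall x x' y y', G x y -> G x' y' -> G (x * x') (y * y')) ->
  exists h : {rmorphism R -> S}, forall x, G x (h x).
Proof.
move=> /choice[h Gh] Gfun G1 GB GM.
have hB : zmod_morphism h by move=> x y; apply: Gfun (Gh _) (GB _ _ _ _ _ _).
have hM : monoid_morphism h.
  split=> [|x y]; first exact: Gfun (Gh _) G1.
  by apply: Gfun (Gh _) (GM _ _ _ _ _ _).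
pose h' : {rmorphism R -> S} := HB.pack h
  (GRing.isZmodMorphism.Build R S h hB) (GRing.isMonoidMorphism.Build R S h hM).
by exists h'.
Qed.

Lemma ideal_quotient (R : comPzRingType) (J : R -> Prop) : is_ideal J ->
  exists (Q : comPzRingType) (pi : {rmorphism R -> Q}),
    (forall q, exists x, pi x = q) /\ (forall x, pi x = 0 <-> J x).
Proof.
case=> J0 JD JM.
have JN x : J x -> J (- x) by rewrite -mulN1r; exact: JM.
have Jeq x y : x = y -> J (x - y) by move->; rewrite subrr.
have [|Q [cl [cl_surj clE [cl0 cl1] clN [clD clM]]]] :=
  @quotient_by_congruence R (fun x y => J (x - y)) 0 1 -%R +%R *%R.
  split; try by move=> *; apply: Jeq;
    rewrite ?subrr // ?addrA ?mulrA ?add0r ?addNr ?mul1r ?mulrDl //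
      1?addrC 1?mulrC.
  - by move=> x y /JN; rewrite opprB.
  - by move=> y x z xy yz; rewrite -(subrKA y); exact: JD.
  - by move=> x x' /JN; rewrite opprD.
  - by move=> x x' y y' xx yy; rewrite opprD addrACA; exact: JD.
  - move=> x x' y y' xx yy; rewrite -(subrKA (x' * y)) -mulrBl -mulrBr.
    by rewrite [_ * y]mulrC; apply: JD; exact: JM.
have [|x y y' <- <- //|//|x x' y y' <- <-|x x' y y' <- <-|pi piE] :=
  @rmorphism_of_graph R Q (fun x q => cl x = q); try by rewrite ?clD ?clN ?clM.
  by move=> x; exists (cl x).
exists Q, pi; split=> [q|x].
  by have [x <-] := cl_surj q; exists x.
by rewrite -piE -cl0 clE subr0.
Qed.

Lemma factor_surjection (R Q C : comPzRingType) (pi : {rmorphism R -> Q})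
    (g : {rmorphism R -> C}) :
  (forall q, exists x, pi x = q) -> (forall x, pi x = 0 -> g x = 0) ->
  exists h : {rmorphism Q -> C}, h \o pi =1 g.
Proof.
move=> pi_surj gker.
have [|q y y'|//|||h hE] :=
  @rmorphism_of_graph Q C (fun q c => exists2 x, pi x = q & g x = c).
- by move=> q; have [x <-] := pi_surj q; exists (g x), x.
- move=> [x <- <-] [x' xx' <-]; apply/eqP; rewrite -subr_eq0 -rmorphB gker //.
  by rewrite rmorphB xx' subrr.
- by exists 1; rewrite rmorph1.
- by move=> _ _ _ _ [x <- <-] [y <- <-]; exists (x - y); rewrite rmorphB.
- by move=> _ _ _ _ [x <- <-] [y <- <-]; exists (x * y); rewrite rmorphM.
exists h => x /=; have [x' xx' <-] := hE (pi x).
by apply/eqP; rewrite -subr_eq0 -rmorphB gker // rmorphB xx' subrr.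
Qed.

(** * Polynomial rings and finitely presented maps *)

Section Terms.
Variables (A : comPzRingType) (n : nat).

Inductive term : Type :=
  | Const of A | Var of 'I_n | Opp of term
  | Add of term & term | Mul of term & term.

Fixpoint eval (C : comPzRingType) (g : A -> C) (c : 'I_n -> C) (t : term) : C :=
  match t with
  | Const a => g a
  | Var i => c i
  | Opp t => - eval g c t
  | Add t u => eval g c t + eval g c u
  | Mul t u => eval g c t * eval g c u
  end.

(** Two expressions denote the same polynomial when they agree under every
    evaluation.  The ring laws and the universal property then hold for free,
    whether or not A is zero. *)
Definition identical (t u : term) : Prop :=
  forall (C : comPzRingType) (g : {rmorphism A -> C}) (c : 'I_n -> C),
  eval g c t = eval g c u.

(** The quotient of the expressions by [identical] is the polynomial ring:
    evaluation descends to it by the choice of the relation, and a map out of it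
    is determined on expressions by induction. *)
Lemma polynomial_ring_exists :
  exists (P : comPzRingType) (iota : {rmorphism A -> P}) (x : 'I_n -> P),
    polynomial_ring iota x.
Proof.
have [|P [cl [cl_surj clE [cl0 cl1] clN [clD clM]]]] :=
  @quotient_by_congruence term identical (Const 0) (Const 1) Opp Add Mul.
  split.
  - by [].
  - by move=> t u tu C g c; rewrite tu.
  - by move=> u t v tu uv C g c; rewrite tu uv.
  - by move=> t t' tt C g c /=; rewrite tt.
  - by move=> t t' u u' tt uu C g c /=; rewrite tt uu.
  - by move=> t t' u u' tt uu C g c /=; rewrite tt uu.
  - by move=> t u v C g c /=; rewrite addrA.
  - by move=> t u C g c /=; rewrite addrC.
  - by move=> t C g c /=; rewrite rmorph0 add0r.
  - by move=> t C g c /=; rewrite rmorph0 addNr.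
  - by move=> t u v C g c /=; rewrite mulrA.
  - by move=> t u C g c /=; rewrite mulrC.
  - by move=> t C g c /=; rewrite rmorph1 mul1r.
  - by move=> t u v C g c /=; rewrite mulrDl.
have [|x y y' <- <- //|//|x x' y y' <- <-|x x' y y' <- <-|iota iotaE] :=
  @rmorphism_of_graph A P (fun a p => cl (Const a) = p).
- by move=> a; exists (cl (Const a)).
- by rewrite -clN -clD; apply/clE => C g c /=; rewrite rmorphB.
- by rewrite -clM; apply/clE => C g c /=; rewrite rmorphM.
exists P, iota, (cl \o Var) => C g c.
have [|p y y'|||//|h hE] :=
  @rmorphism_of_graph P C (fun p y => exists2 t, cl t = p & eval g c t = y).
- by move=> p; have [t <-] := cl_surj p; exists (eval g c t), t.
- by move=> [t <- <-] [u /clE ut <-]; rewrite ut.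
- by exists (Const 1) => //=; rewrite rmorph1.
- move=> _ _ _ _ [t <- <-] [u <- <-]; exists (Add t (Opp u)) => //.
  by rewrite clD clN.
- by move=> _ _ _ _ [t <- <-] [u <- <-]; exists (Mul t u).
have hcl t : h (cl t) = eval g c t.
  by have [u /clE ut <-] := hE (cl t); rewrite ut.
exists h; split=> [a|i|h' h'i h'x p] /=.
- by rewrite -iotaE hcl.
- by rewrite hcl.
have [t <-] := cl_surj p; rewrite hcl.
elim: t => [a|i|t IHt|t IHt u IHu|t IHt u IHu] /=.
- by rewrite iotaE; exact: h'i.
- exact: h'x.
- by rewrite clN rmorphN IHt.
- by rewrite clD rmorphD IHt IHu.
- by rewrite clM rmorphM IHt IHu.
Qed.

End Terms.

Lemma span_quotient (P : comPzRingType) (k : nat) (r : 'I_k -> P) :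
  exists (D : comPzRingType) (pi : {rmorphism P -> D}),
    (forall d, exists p, pi p = d) /\
    (forall p, pi p = 0 <-> exists c, p = \sum_(j < k) c j * r j).
Proof.
apply: ideal_quotient; split.
- by exists (fun=> 0); rewrite big1 // => j _; rewrite mul0r.
- move=> _ _ [c ->] [d ->]; exists (fun j => c j + d j).
  by rewrite -big_split; apply: eq_bigr => j _; rewrite mulrDl.
- move=> a _ [c ->]; exists (fun j => a * c j).
  by rewrite mulr_sumr; apply: eq_bigr => j _; rewrite mulrA.
Qed.

Lemma generator_in_kernel (P D : comPzRingType) (k : nat) (r : 'I_k -> P)
    (pi : {rmorphism P -> D}) :
  (forall p, pi p = 0 <-> exists c, p = \sum_(j < k) c j * r j) ->
  forall j, pi (r j) = 0.
Proof.
move=> kerE j; apply/kerE; exists (fun i => (i == j)%:R).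
rewrite (bigD1 j) //= eqxx mul1r big1 ?addr0 // => i /negbTE ->.
by rewrite mul0r.
Qed.

Lemma factor_span_quotient (P D C : comPzRingType) (k : nat) (r : 'I_k -> P)
    (pi : {rmorphism P -> D}) (g : {rmorphism P -> C}) :
  (forall d, exists p, pi p = d) ->
  (forall p, pi p = 0 <-> exists c, p = \sum_(j < k) c j * r j) ->
  (forall j, g (r j) = 0) ->
  exists h : {rmorphism D -> C}, h \o pi =1 g.
Proof.
move=> pi_surj kerE gr; apply: factor_surjection => // _ /kerE[c ->].
by rewrite rmorph_sum big1 // => j _; rewrite rmorphM gr mulr0.
Qed.

Lemma polynomial_ring_ext (A P C : comPzRingType) n (iota : {rmorphism A -> P})
    (x : 'I_n -> P) (h h' : {rmorphism P -> C}) :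
  polynomial_ring iota x -> h \o iota =1 h' \o iota -> h \o x =1 h' \o x ->
  h =1 h'.
Proof.
move=> polyP hi hx p.
by have [g [_ _ g_uniq]] := polyP C (h' \o iota) (h' \o x); rewrite !g_uniq.
Qed.

(** * Base change *)

Definition pushout (A A' B D : comPzRingType) (f : {rmorphism A -> A'})
    (u : {rmorphism A -> B}) (f' : {rmorphism B -> D})
    (v : {rmorphism A' -> D}) : Prop :=
  [/\ v \o f =1 f' \o u,
      forall (C : comPzRingType) (g : {rmorphism B -> C})
             (w : {rmorphism A' -> C}),
        w \o f =1 g \o u ->
        exists h : {rmorphism D -> C}, h \o f' =1 g /\ h \o v =1 w
    & forall (C : comPzRingType) (h h' : {rmorphism D -> C}),
        h \o f' =1 h' \o f' -> h \o v =1 h' \o v -> h =1 h'].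

(** If A' = A[x]/(r), then D = B[x]/(u(r)): the variables and relations stay the
    same and only the coefficients change. *)
Lemma finitely_presented_base_change (A A' B : comPzRingType)
    (f : {rmorphism A -> A'}) (u : {rmorphism A -> B}) :
  finitely_presented f ->
  exists (D : comPzRingType) (f' : {rmorphism B -> D})
         (v : {rmorphism A' -> D}),
    finitely_presented f' /\ pushout f u f' v.
Proof.
move=> [n [P [iota [x [pi [k [r [polyP pif pi_surj kerE]]]]]]]].
have [PB [iB [xB polyPB]]] := polynomial_ring_exists B n.
have [phi [phi_iota phi_x _]] := polyP PB (iB \o u) xB.
have [D [pB [pB_surj kerB]]] := span_quotient (phi \o r).
have pBr := generator_in_kernel kerB.
have [v v_pi] :=
  @factor_span_quotient P A' D k r pi (pB \o phi) pi_surj kerE pBr.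
have pir := generator_in_kernel kerE.
exists D, (pB \o iB), v; split.
  by exists n, PB, iB, xB, pB, k, (phi \o r).
split.
- by move=> a /=; rewrite -pif -[RHS]/(pB ((iB \o u) a)) -phi_iota; exact: v_pi.
- move=> C g w wf.
  have [h0 [h0i h0x _]] := polyPB C g (w \o pi \o x).
  have h0phi : h0 \o phi =1 w \o pi.
    apply: (polynomial_ring_ext polyP) => [a|i] /=.
      rewrite -[LHS]/(h0 ((phi \o iota) a)) phi_iota.
      rewrite -[LHS]/((h0 \o iB) (u a)) h0i -[LHS]/((g \o u) a) -wf /=.
      by rewrite -pif.
    by rewrite -[LHS]/(h0 ((phi \o x) i)) phi_x; exact: h0x.
  have [|h hpB] := @factor_span_quotient PB D C k (phi \o r) pB h0 pB_surj kerB.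
    by move=> j; rewrite -[LHS]/((h0 \o phi) (r j)) h0phi /= pir rmorph0.
  exists h; split=> [b|a'].
    by rewrite -[LHS]/((h \o pB) (iB b)) hpB; exact: h0i.
  have [p <-] := pi_surj a'.
  rewrite -[LHS]/(h ((v \o pi) p)) v_pi -[LHS]/((h \o pB) (phi p)) hpB.
  exact: h0phi.
- move=> C h h' hf hv d; have [q <-] := pB_surj d.
  apply: (polynomial_ring_ext (h := h \o pB) (h' := h' \o pB) polyPB) => [b|i].
    exact: hf.
  have e : pB (xB i) = v (pi (x i)).
    by rewrite -[RHS]/((v \o pi) (x i)) v_pi /= -phi_x.
  by rewrite /= e; exact: hv.
Qed.

(** A lifting problem for f' restricts along A' -> D to one for f; the universal
    property glues its solution with the given map on B. *)
Lemma formally_etale_base_change (A A' B D : comPzRingType)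
    (f : {rmorphism A -> A'}) (u : {rmorphism A -> B}) (f' : {rmorphism B -> D})
    (v : {rmorphism A' -> D}) :
  pushout f u f' v -> formally_etale f -> formally_etale f'.
Proof.
move=> [vf po po_uniq] fet R S p p0 a b bf.
have [c|w [wf pw w_uniq]] := fet R S p p0 (a \o u) (b \o v).
  by rewrite /= -[v _]/((v \o f) c) vf; exact: bf.
have [h [hf hv]] := po R a w wf.
exists h; split=> //.
  apply: (po_uniq _ (p \o h) b) => [c|c] /=.
    by rewrite -[h _]/((h \o f') c) hf; exact/esym/bf.
  by rewrite -[h _]/((h \o v) c) hv; exact: pw.
move=> h' h'f ph'; apply: po_uniq => c; first by rewrite h'f hf.
rewrite hv; apply: (w_uniq (h' \o v)) => [e|e]; last exact: ph'.
by rewrite /= -[v _]/((v \o f) e) vf; exact: h'f.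
Qed.

Lemma etale_base_change (A A' B : comPzRingType)
    (f : {rmorphism A -> A'}) (u : {rmorphism A -> B}) :
  etale f ->
  exists (D : comPzRingType) (f' : {rmorphism B -> D})
         (v : {rmorphism A' -> D}),
    etale f' /\ pushout f u f' v.
Proof.
case=> fet /(finitely_presented_base_change u)[D [f' [v [f'fp po]]]].
exists D, f', v; split=> //; split=> //.
exact: formally_etale_base_change po fet.
Qed.

(** * Localisation *)

Definition invertible (R : comPzRingType) (x : R) : Prop := exists y, x * y = 1.

Lemma invertible_rmorph (R S : comPzRingType) (f : {rmorphism R -> S}) (x : R) :
  invertible x -> invertible (f x).
Proof. by case=> y xy; exists (f y); rewrite -rmorphM xy rmorph1. Qed.

(** If x y = 1 + e with e in the kernel, then e * e = 0 and y (1 - e) is an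
    inverse of x. *)
Lemma invertible_lift (R S : comPzRingType) (p : {rmorphism R -> S}) (x : R) :
  square_zero_surjection p -> invertible (p x) -> invertible x.
Proof.
move=> [p_surj p0] [s]; have [y <-] := p_surj s; rewrite -rmorphM => xy.
pose e := x * y - 1.
have pe : p e = 0 by rewrite rmorphB rmorph1 xy subrr.
exists (y * (1 - e)); rewrite mulrA -[x * y](subrK 1) -/e.
by rewrite mulrBr mulr1 mulrDl mul1r (p0 e e) // add0r addrC addKr.
Qed.

Definition localization_at (A D : comPzRingType) (x : A)
    (f : {rmorphism A -> D}) : Prop :=
  [/\ etale f, invertible (f x)
    & forall (C : comPzRingType) (u : {rmorphism A -> C}), invertible (u x) ->
      exists g : {rmorphism D -> C}, g \o f =1 u].

(** The localisation is A[t]/(x t - 1).  It is formally etale because a lift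
    exists as soon as x becomes invertible, which [invertible_lift] ensures, and
    because inverses are unique, so that A -> D is an epimorphism. *)
Lemma localization_exists (A : comPzRingType) (x : A) :
  exists (D : comPzRingType) (f : {rmorphism A -> D}), localization_at x f.
Proof.
have [P [iota [t polyP]]] := polynomial_ring_exists A 1.
pose r (_ : 'I_1) : P := iota x * t ord0 - 1.
have [D [pi [pi_surj kerE]]] := span_quotient r.
have pir := generator_in_kernel kerE.
pose f : {rmorphism A -> D} := pi \o iota.
have fxt : f x * pi (t ord0) = 1.
  apply/eqP; rewrite -subr_eq0 -[f x]/(pi (iota x)) -rmorphM.
  by rewrite -(rmorph1 pi) -rmorphB (pir ord0).
have fac (C : comPzRingType) (u : {rmorphism A -> C}) : invertible (u x) ->
    exists g : {rmorphism D -> C}, g \o f =1 u.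
  move=> [y uxy]; have [h [hi ht _]] := polyP C u (fun=> y).
  have hr j : h (r j) = 0.
    rewrite rmorphB rmorphM rmorph1 -[h (iota x)]/((h \o iota) x) hi.
    by rewrite -[h (t _)]/((h \o t) ord0) ht uxy subrr.
  have [g gpi] := factor_span_quotient pi_surj kerE hr.
  by exists g => a; rewrite -hi; exact: gpi.
have epi (C : comPzRingType) (h h' : {rmorphism D -> C}) :
    h \o f =1 h' \o f -> h =1 h'.
  move=> hf d; have [p <-] := pi_surj d.
  apply: (polynomial_ring_ext (h := h \o pi) (h' := h' \o pi) polyP) => // i.
  rewrite /= (ord1 i) -[LHS]mulr1 -[1](rmorph1 h') -fxt rmorphM.
  rewrite -[h' (f x)]/((h' \o f) x) -hf mulrA -rmorphM mulrC [_ * f x]mulrC fxt.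
  by rewrite rmorph1 mulr1.
exists D, f; split=> //; last by exists (pi (t ord0)).
split; last by exists 1, P, iota, t, pi, 1, r.
move=> R S p p0 u v vf.
have [|w wf] := fac R u.
  apply: (invertible_lift p0); rewrite -[p _]/((p \o u) x) -vf.
  by apply: (invertible_rmorph v); exists (pi (t ord0)).
exists w; split=> // [|w' w'f _]; last by apply: epi => a; rewrite w'f wf.
apply: (epi _ (p \o w) v) => a.
by rewrite vf /=; congr (p _); exact: wf.
Qed.

(** Points are local rings.  If the localisation D at y is zero, then so is
    K/(1 - y), as y maps to 1 there and hence K/(1 - y) receives a map from
    D. *)
Lemma etale_point_invertible (K : comPzRingType) (y : K) :
  etale_point K -> invertible y \/ invertible (1 - y).
Proof.
move=> [_ Kpt]; have [D [f [fet fy fac]]] := localization_exists y.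
have [D0|/(Kpt _ _ fet)[s fK]] := pselect ((1 : D) = 0); last first.
  by left; rewrite -(fK y); exact: invertible_rmorph.
right; have [|Q [pi [pi_surj kerE]]] :=
  @ideal_quotient K (fun a => exists b, a = (1 - y) * b).
  split; first by exists 0; rewrite mulr0.
    by move=> _ _ [a ->] [b ->]; exists (a + b); rewrite mulrDr.
  by move=> c _ [a ->]; exists (c * a); rewrite mulrCA.
have pi1y : pi (1 - y) = 0 by apply/kerE; exists 1; rewrite mulr1.
have [|g _] := fac Q pi.
  exists 1; rewrite mulr1; apply/eqP.
  by rewrite eq_sym -subr_eq0 -[1](rmorph1 pi) -rmorphB pi1y.
have /kerE[b e] : pi 1 = 0 by rewrite rmorph1 -(rmorph1 g) D0 rmorph0.
by exists b.
Qed.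

(** * Local rings and residue fields *)

Lemma nonunits_local (R : comPzRingType) : (1 : R) <> 0 ->
  (forall y : R, invertible y \/ invertible (1 - y)) ->
  local_ring (fun x : R => ~ invertible x).
Proof.
move=> R1 Rloc.
have inv_factor (x c : R) : invertible (c * x) -> invertible x.
  by case=> d cxd; exists (c * d); rewrite mulrCA mulrA.
have idl : is_ideal (fun x : R => ~ invertible x).
  split; first by case=> y; rewrite mul0r => /esym.
    move=> x y Nx Ny [c xyc].
    (* c inverts x + y, so that x c and y c = 1 - x c add up to 1. *)
    have [[d xcd]|] := Rloc (x * c).
      by apply: Nx; exists (c * d); rewrite mulrA.
    rewrite -xyc mulrDl addrC addKr => -[d ycd]; apply: Ny; exists (c * d).
    by rewrite mulrA.
  by move=> a x Nx /inv_factor.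
have Nproper (J : R -> Prop) : is_ideal J -> ~ J 1 ->
    forall x, J x -> ~ invertible x.
  by move=> [_ _ JM] NJ1 x Jx [y xy]; apply: NJ1; rewrite -xy mulrC; exact: JM.
have N1 : ~ ~ invertible (1 : R) by apply; exists 1; rewrite mulr1.
split; first by split=> // J idJ NJ1 _; exact: Nproper.
move=> n [idn Nn1 nmax] x; split; first exact: (Nproper n idn Nn1).
exact: (nmax (fun z => ~ invertible z) idl N1 (Nproper n idn Nn1)).
Qed.

(** A map killing m factors through B/m, which is C/n, and can be composed with
    C -> C/n: send c to g(a) for any a congruent to c modulo n. *)
Lemma extend_along_residue (B C R : comPzRingType) (f : {rmorphism B -> C})
    (m : B -> Prop) (n : C -> Prop) (g : {rmorphism B -> R}) :
  is_ideal n -> same_residue_field f n m -> (forall a, m a -> g a = 0) ->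
  exists h : {rmorphism C -> R}, h \o f =1 g.
Proof.
move=> [n0 nD nM] [res_inj res_surj] g0.
have nB x y : n x -> n y -> n (x - y).
  by move=> nx ny; apply: nD => //; rewrite -mulN1r; exact: nM.
have [|c y y' [a na <-] [a' na' <-]||||h hE] :=
  @rmorphism_of_graph C R (fun c y => exists2 a, n (c - f a) & g a = y).
- by move=> c; have [a na] := res_surj c; exists (g a), a.
- apply/eqP; rewrite -subr_eq0 -rmorphB g0 //; apply: res_inj.
  by rewrite -[f a - _](subrKA c) -opprB addrC; exact: nB.
- by exists 1; rewrite ?rmorph1 ?subrr.
- move=> c c' _ _ [a na <-] [a' na' <-]; exists (a - a'); last exact: rmorphB.
  by rewrite rmorphB !opprD addrACA -opprD; exact: nB.
- move=> c c' _ _ [a na <-] [a' na' <-]; exists (a * a'); last exact: rmorphM.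
  rewrite rmorphM -(subrKA (f a * c')) -mulrBl -mulrBr.
  by rewrite mulrC; apply: nD; exact: nM.
exists h => a /=; have [a' na <-] := hE (f a).
apply/eqP; rewrite -subr_eq0 -rmorphB g0 //; apply: res_inj.
by rewrite -opprB -sub0r; exact: nB.
Qed.

Lemma residue_field (R : comPzRingType) (m : R -> Prop) : maximal_ideal m ->
  exists (K : fieldType) (pi : {rmorphism R -> K}),
    (forall y, exists x, pi x = y) /\ (forall x, pi x = 0 <-> m x).
Proof.
move=> [idm Nm1 mmax]; have [m0 mD mM] := idm.
have [Q [pi [pi_surj kerE]]] := ideal_quotient idm.
have Qinv (q : Q) : exists q', if q == 0 then q' = 0 else q' * q = 1.
  case: eqP => [_|q0]; first by exists 0.
  have [x xq] := pi_surj q.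
  apply: contrapT => Nq; apply: q0; rewrite -xq; apply/kerE.
  (* If x were not invertible modulo m, the ideal m + (x) would be proper. *)
  apply: (mmax (fun z => exists2 y, m y & exists a, z = y + a * x)).
  - split; first by exists 0 => //; exists 0; rewrite mul0r addr0.
      move=> _ _ [y my [a ->]] [y' my' [a' ->]]; exists (y + y').
        exact: mD.
      by exists (a + a'); rewrite mulrDl addrACA.
    move=> c _ [y my [a ->]]; exists (c * y); first exact: mM.
    by exists (c * a); rewrite mulrDr mulrA.
  - move=> [y /kerE my [a yax]]; apply: Nq; exists (pi a).
    by rewrite -xq -rmorphM -[LHS]add0r -my -rmorphD -yax rmorph1.
  - by move=> y my; exists y => //; exists 0; rewrite mul0r addr0.
  - by exists 0 => //; exists 1; rewrite mul1r add0r.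
have [inv invE] := choice Qinv.
have Q1 : (1 : Q) != 0.
  by apply/eqP=> e; apply/Nm1/kerE; rewrite rmorph1.
pose QN : comNzRingType := HB.pack Q (GRing.PzSemiRing_isNonZero.Build Q Q1).
have iV (x : QN) : x != 0 -> inv x * x = 1.
  by move=> /negbTE x0; have := invE x; rewrite [_ == _]x0.
have i0 : inv 0 = 0 by have := invE 0; rewrite eqxx.
pose K : fieldType := HB.pack QN (GRing.ComNzRing_isField.Build QN iV i0).
by exists K, pi.
Qed.

(** * Nisnevich local objects *)

Lemma localization_family (A : comPzRingType) (I : Type) (x : I -> A) :
  exists (Ai : I -> comPzRingType) (f : forall i, {rmorphism A -> Ai i}),
    forall i, localization_at (x i) (f i).
Proof.
have [|L LP] := @choice I {D : comPzRingType & {rmorphism A -> D}}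
    (fun i L => localization_at (x i) (projT2 L)).
  by move=> i; have [D [f fP]] := localization_exists (x i);
    exists (existT _ D f).
by exists (fun i => projT1 (L i)), (fun i => projT2 (L i)).
Qed.

(** Lift the residue field point of B through the covering family, and turn it
    into a B-point by a retraction of the base change. *)
Lemma henselian_local_is_nisnevich_local (B : comPzRingType) :
  henselian_local_ring B -> nisnevich_local B.
Proof.
move=> [m [[mmax _] hens]] A I Ai f [[fet _] cover] u.
have [K [pi [pi_surj kerE]]] := residue_field mmax.
have [i [g gf]] := cover K (pi \o u).
have [D [f' [v [f'et [vf po _]]]]] := etale_base_change u (fet i).
have [h [hf hv]] := po K pi g gf.
have [|s sK] := hens D f' f'et; last first.
  by exists i, (s \o v) => a; rewrite -[LHS]/(s ((v \o f i) a)) vf; exact: sK.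
have hfE b : h (f' b) = pi b by exact: hf.
exists (fun d => h d = 0); split; last split.
- split; first split.
  + exact: rmorph0.
  + by move=> x y hx hy; rewrite rmorphD hx hy addr0.
  + by move=> a x hx; rewrite rmorphM hx mulr0.
  + by rewrite rmorph1; apply/eqP/oner_neq0.
  + move=> J [_ JD JM] NJ1 nJ x Jx; apply: contrapT => /eqP hx0; apply: NJ1.
    have [b pib] := pi_surj (h x)^-1.
    rewrite -(subrK (f' b * x) 1); apply: JD; last exact: JM.
    by apply: nJ; rewrite rmorphB rmorphM rmorph1 hfE pib mulVf // subrr.
- by move=> b; rewrite hfE.
- by move=> a a'; rewrite -rmorphB hfE kerE.
- move=> d; have [b pib] := pi_surj (h d); exists b.
  by rewrite rmorphB hfE pib subrr.
Qed.

Lemma field_invertible (K : fieldType) (y : K) : y <> 0 -> invertible y.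
Proof. by move=> /eqP y0; exists y^-1; rewrite divff. Qed.

(** The zero ring is covered by the empty family, as it has no map to a field or
    to a point. *)
Lemma nisnevich_local_nontrivial (B : comPzRingType) :
  nisnevich_local B -> (1 : B) <> 0.
Proof.
move=> Bloc B0.
have triv (K : comPzRingType) (u : {rmorphism B -> K}) : (1 : K) = 0.
  by rewrite -(rmorph1 u) B0 rmorph0.
pose f (i : void) : {rmorphism B -> B} := of_void _ i.
have [|[]] // := Bloc B void (fun=> B) f _ idfun.
split; first by split=> [[]|K u [/(_ (triv K u))]].
by move=> K u; have /eqP := triv K u; rewrite oner_eq0.
Qed.

Lemma nisnevich_local_invertible (B : comPzRingType) (y : B) :
  nisnevich_local B -> invertible y \/ invertible (1 - y).
Proof.
move=> Bloc.
have [Ai [f fP]] :=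
  localization_family (fun b : bool => if b then y else 1 - y).
have fac (K : comPzRingType) (u : {rmorphism B -> K}) :
    invertible (u y) \/ invertible (1 - u y) -> factors_through_family f u.
  rewrite -(rmorph1 u) -rmorphB => -[uy|uy].
    by exists true; have [_ _] := fP true; exact.
  by exists false; have [_ _] := fP false; exact.
have [|b [g gf]] := Bloc B bool Ai f _ idfun.
  split; first split=> [b|K u Kpt]; first by have [] := fP b.
    exact/fac/etale_point_invertible.
  move=> K u; apply: fac; have [->|uy] := pselect (u y = 0).
    by right; exists 1; rewrite subr0 mulr1.
  by left; exact: field_invertible.
have [_ /(invertible_rmorph g) inv _] := fP b; move: inv.
by rewrite -[g _]/((g \o f b) _) gf; case: b {gf g}; [left|right].
Qed.

(** The family consisting of C and of the localisations at all nonunits is a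
    covering, and the identity of B can only factor through C. *)
Lemma nisnevich_local_henselian (B : comPzRingType) : nisnevich_local B ->
  henselian (fun x : B => ~ invertible x).
Proof.
move=> Bloc C f fet [n [[idn _ _] _ res]].
have [Li [l lP]] := localization_family (@sval B (fun x => ~ invertible x)).
pose Ai i := if i is Some j then Li j else C.
pose fi i : {rmorphism B -> Ai i} :=
  if i is Some j return {rmorphism B -> Ai i} then l j else f.
have fac (K : comPzRingType) (u : {rmorphism B -> K}) :
    ((forall x, ~ invertible x -> ~ invertible (u x)) ->
      exists g : {rmorphism C -> K}, g \o f =1 u) ->
    factors_through_family fi u.
  have [[x Nx ux] _|Nu facC] :=
    pselect (exists2 x, ~ invertible x & invertible (u x)).
    have [_ _ /(_ K u ux)[g gl]] := lP (exist _ x Nx).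
    by exists (Some (exist _ x Nx)), g.
  have [x Nx ux|g gf] := facC; first by apply: Nu; exists x.
  by exists None, g.
have [|[j|] [g gf]] := Bloc B _ Ai fi _ idfun; last by exists g.
- split; first split=> [[j|]|K u Kpt] //; first by have [] := lP j.
    apply: fac => uloc; have [K1 Kret] := Kpt.
    have [|kmax _] := nonunits_local K1.
      by move=> y; exact: etale_point_invertible.
    have [k [rho [_ kerE]]] := residue_field kmax.
    have [|h hf] := extend_along_residue (g := rho \o u) idn res.
      by move=> x Nx; apply/kerE/uloc.
    have [D [f' [v [f'et [vf po _]]]]] := etale_base_change u fet.
    (* t shows that D is nonzero: it maps to the residue field k of K. *)
    have [t _] := po k rho h hf.
    have [|s sK] := Kret D f' f'et.
      by move=> D0; have /eqP := oner_neq0 k; rewrite -(rmorph1 t) D0 rmorph0.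
    by exists (s \o v) => b; rewrite -[LHS]/(s ((v \o f) b)) vf; exact: sK.
  move=> K u; apply: fac => uloc; apply: (extend_along_residue idn res) => x Nx.
  by apply: contrapT => /field_invertible; exact: uloc.
- have [_ /(invertible_rmorph g) inv _] := lP j; case: (svalP j).
  by move: inv; rewrite -[g _]/((g \o fi (Some j)) _) gf.
Qed.

Theorem proposition80 (B : comPzRingType) :
  nisnevich_local B <-> henselian_local_ring B.
Proof.
split; last exact: henselian_local_is_nisnevich_local.
move=> Bloc; exists (fun x => ~ invertible x); split.
  apply: nonunits_local; first exact: nisnevich_local_nontrivial.
  by move=> y; exact: nisnevich_local_invertible.
exact: nisnevich_local_henselian.
Qed.
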